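(* Let $k\ge 1$ and for $0\le a\le k$ let $\hat a$ denote the class of $[a]=\{1,\dots,a\}$ in $\langle P[k]\rangle/S_k$ (so $\hat 0,\dots,\hat k$ form a basis). Then for $0\le a,b\le k$: (1) with $m=\min(k-a,b)$, $\hat a\cup\hat b=\frac{1}{\binom{k}{b}}\sum_{l=0}^{m}\binom{a}{b-l}\binom{k-a}{l}\,\widehat{a+l}$; (2) with $m=\min(a,b)$, $\hat a\cap\hat b=\frac{1}{\binom{k}{b}}\sum_{l=0}^{m}\binom{a}{l}\binom{k-a}{b-l}\,\hat l$; (3) $(\hat a)^c=\widehat{k-a}$.
   Context: $\mathbb{K}$ is a field of characteristic zero, $[k]=\{1,\dots,k\}$, $\langle P[k]\rangle$ is the $\mathbb{K}$-vector space with basis the subsets of $[k]$, with union and intersection the bilinear extensions of the set operations and complement the linear extension of $a\mapsto[k]\setminus a$. $S_k$ acts on $\langle P[k]\rangle$ by $\sigma\cdot c=\sigma(c)$. The coinvariant space $\langle P[k]\rangle/S_k$ (quotient by the span of $\sigma v-v$) carries the induced operations $\bar u\cup\bar v=\frac{1}{k!}\sum_{\sigma\in S_k}\overline{u\cup\sigma v}$, $\bar u\cap\bar v=\frac{1}{k!}\sum_{\sigma\in S_k}\overline{u\cap\sigma v}$, and $\bar u^c=\overline{u^c}$. Binomial coefficients $\binom{p}{q}$ are $0$ when $q<0$ or $q>p$. *)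

(* Defs.v *)
From HB Require Import structures.
From mathcomp Require Import all_boot all_fingroup all_algebra.

Set Implicit Arguments.
Unset Strict Implicit.
Unset Printing Implicit Defensive.

Import GRing.Theory VectorInternalTheory.
Local Open Scope ring_scope.
Local Open Scope quotient_scope.

Section QuotientSpace.

Variables (K : fieldType) (V : vectType K) (U : {vspace V}).

(* MathComp only equips the quotient by a subgroup with a zmodType structure;
   scaling and finite dimension are added here for the quotient by a subspace. *)
Definition quotv := Quotient.quot U.

HB.instance Definition _ := GRing.Zmodule.on quotv.

Definition quotv_pi (v : V) : quotv := \pi_(Quotient.quot U) v.
Definition quotv_repr (x : quotv) : V := generic_quotient.repr (x : Quotient.quot U).

Lemma quotv_reprK x : quotv_pi (quotv_repr x) = x.
Proof. exact: reprK. Qed.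

Lemma quotv_piP u v : reflect (quotv_pi u = quotv_pi v) (u - v \in U).
Proof. by rewrite Quotient.idealrBE; apply: eqP. Qed.

Lemma quotv_repr_pi v : quotv_repr (quotv_pi v) - v \in U.
Proof. by apply/quotv_piP; rewrite quotv_reprK. Qed.

Lemma quotv_piD u v : quotv_pi (u + v) = quotv_pi u + quotv_pi v.
Proof. exact: pi_addr. Qed.

Definition quotv_scale (c : K) (x : quotv) : quotv :=
  quotv_pi (c *: quotv_repr x).

Lemma quotv_scale_pi c v : quotv_scale c (quotv_pi v) = quotv_pi (c *: v).
Proof. by apply/quotv_piP; rewrite -scalerBr rpredZ ?quotv_repr_pi. Qed.

Fact quotv_scaleA a b x :
  quotv_scale a (quotv_scale b x) = quotv_scale (a * b) x.
Proof. by rewrite -[x]quotv_reprK !quotv_scale_pi scalerA. Qed.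

Fact quotv_scale1 : left_id 1 quotv_scale.
Proof. by move=> x; rewrite -[x]quotv_reprK quotv_scale_pi scale1r. Qed.

Fact quotv_scaleDr : right_distributive quotv_scale +%R.
Proof.
move=> a x y; rewrite -[x]quotv_reprK -[y]quotv_reprK -quotv_piD.
by rewrite !quotv_scale_pi -quotv_piD scalerDr.
Qed.

Fact quotv_scaleDl x : {morph quotv_scale^~ x : a b / a + b}.
Proof.
by move=> a b; rewrite -[x]quotv_reprK !quotv_scale_pi -quotv_piD scalerDl.
Qed.

HB.instance Definition _ := GRing.Zmodule_isLmodule.Build K quotv
  quotv_scaleA quotv_scale1 quotv_scaleDr quotv_scaleDl.

Fact quotv_pi_linear : linear quotv_pi.
Proof. by move=> a u v; rewrite quotv_piD -quotv_scale_pi. Qed.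

HB.instance Definition _ :=
  GRing.isLinear.Build K V quotv _ quotv_pi quotv_pi_linear.

Fact quotv_vect_iso : Vector.axiom (dim (subvs_of U^C)) quotv.
Proof.
have UC0 : (U^C :&: U = 0)%VS by rewrite capvC capv_compl.
have mem_sum w : w \in (U^C + U)%VS by rewrite addvC addv_complf memvf.
pose g v := vsproj U^C (daddv_pi U^C U v).
have val_g v : vsval (g v) = daddv_pi U^C U v by rewrite vsprojK ?memv_pi.
have g_lin : linear g by move=> a u v; rewrite /g !linearP.
have gB u v : g (u - v) = g u - g v by rewrite /g !raddfB.
have subg v : v - vsval (g v) \in U.
  by rewrite val_g -{1}(daddv_pi_add UC0 (mem_sum v)) addrC addKr memv_pi.
have g0 v : v \in U -> g v = 0.
  move=> Uv; apply: val_inj => /=; rewrite val_g.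
  have := daddv_pi_add UC0 (mem_sum v).
  have -> : daddv_pi U U^C v = v by rewrite daddv_pi_id // capv_compl.
  by move/(canRL (addrK _)); rewrite subrr.
have g_pi u v : u - v \in U -> g u = g v.
  by move=> /g0/eqP; rewrite gB subr_eq0 => /eqP.
exists (fun x : quotv => v2r (g (quotv_repr x))) => [a x y|].
  rewrite -linearP -g_lin; congr (v2r _); apply: g_pi; apply/quotv_piP.
  by rewrite quotv_reprK quotv_pi_linear !quotv_reprK.
exists (fun r => quotv_pi (vsval (r2v r : subvs_of U^C))) => [x|r].
  rewrite v2rK -[RHS]quotv_reprK; apply/esym/quotv_piP; exact: subg.
rewrite (g_pi _ (vsval (r2v r : subvs_of U^C))) ?quotv_repr_pi //.
apply: (canLR r2vK); apply: val_inj => /=.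
by rewrite val_g daddv_pi_id // subvsP.
Qed.

HB.instance Definition _ := Lmodule_hasFinDim.Build K quotv quotv_vect_iso.

End QuotientSpace.

Section PowersetSpace.

Variables (K : fieldType) (k : nat).

(* [k] = {1, ..., k} is represented by 'I_k = {0, ..., k - 1}, and <P[k]> by
   the coefficient functions on its subsets. *)
Definition PS := {ffun {set 'I_k} -> K^o}.

HB.instance Definition _ := Vector.on PS.

Definition ps_basis (a : {set 'I_k}) : PS := [ffun c => (c == a)%:R].

Definition ps_ext (f : {set 'I_k} -> {set 'I_k}) (u : PS) : PS :=
  \sum_(a : {set 'I_k}) u a *: ps_basis (f a).

Definition ps_ext2 (f : {set 'I_k} -> {set 'I_k} -> {set 'I_k}) (u v : PS) :
    PS :=
  \sum_(a : {set 'I_k}) \sum_(b : {set 'I_k}) (u a * v b) *: ps_basis (f a b).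

Definition ps_union := ps_ext2 (fun a b => a :|: b).
Definition ps_inter := ps_ext2 (fun a b => a :&: b).
Definition ps_compl := ps_ext (fun a => ~: a).

Definition ps_act (s : 'S_k) := ps_ext (fun c => s @: c).

Fact ps_ext_linear f : linear (ps_ext f).
Proof.
move=> c u v; rewrite /ps_ext scaler_sumr -big_split /=.
by apply: eq_bigr => a _; rewrite !ffunE scalerDl scalerA.
Qed.

HB.instance Definition _ f :=
  GRing.isLinear.Build K PS PS _ (ps_ext f) (ps_ext_linear f).

(* The range of v |-> s v - v is {s v - v | v in <P[k]>}; the span of the union
   of these subspaces over s is their sum. *)
Definition coinv_rel : {vspace PS} :=
  (\sum_(s : 'S_k) limg (linfun (ps_act s) - \1)%VF)%VS.

Definition coinv := quotv coinv_rel.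

HB.instance Definition _ := Vector.on coinv.

Definition cls (u : PS) : coinv := quotv_pi coinv_rel u.

Definition coinv_repr (x : coinv) : PS := quotv_repr x.

(* These are the stated formulas with u, v a choice of representatives; they do
   not depend on that choice, see coinv_unionE, coinv_interE, coinv_complE. *)
Definition coinv_union (x y : coinv) : coinv :=
  (k`!%:R)^-1 *:
    \sum_(s : 'S_k) cls (ps_union (coinv_repr x) (ps_act s (coinv_repr y))).

Definition coinv_inter (x y : coinv) : coinv :=
  (k`!%:R)^-1 *:
    \sum_(s : 'S_k) cls (ps_inter (coinv_repr x) (ps_act s (coinv_repr y))).

Definition coinv_compl (x : coinv) : coinv := cls (ps_compl (coinv_repr x)).

Definition hat (a : nat) : coinv := cls (ps_basis [set i : 'I_k | (i < a)%N]).

Fact cls_linear : linear cls.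
Proof. exact: quotv_pi_linear. Qed.

HB.instance Definition _ :=
  GRing.isLinear.Build K PS coinv _ cls cls_linear.

Lemma cls_act s u : cls (ps_act s u) = cls u.
Proof.
apply/quotv_piP/(subvP (sumv_sup s _ (subvv _))) => //.
have := memv_img (linfun (ps_act s) - \1)%VF (memvf u).
by rewrite add_lfunE opp_lfunE id_lfunE lfunE.
Qed.

Lemma clsP u v : cls u = cls v ->
  exists w : 'S_k -> PS, u = v + \sum_(s : 'S_k) (ps_act s (w s) - w s).
Proof.
move/quotv_piP/memv_sumP => [w w_im uvE].
have /fin_all_exists[z zE] s :
    exists z, w s = ps_act s z - z.
  have /memv_imgP[z _ ->] := w_im s isT; exists z.
  by rewrite add_lfunE opp_lfunE id_lfunE lfunE.
exists z; rewrite -(eq_bigr _ (fun s _ => zE s)) -uvE addrC subrK //.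
Qed.

Lemma ps_ext_basis f a : ps_ext f (ps_basis a) = ps_basis (f a).
Proof.
rewrite /ps_ext (bigD1 a) //= ffunE eqxx scale1r big1 ?addr0 // => b /negPf ba.
by rewrite ffunE ba scale0r.
Qed.

Lemma ps_ext_comp f g u : ps_ext f (ps_ext g u) = ps_ext (f \o g) u.
Proof.
rewrite [ps_ext g u]/ps_ext linear_sum; apply: eq_bigr => a _.
by rewrite linearZ /= ps_ext_basis.
Qed.

Lemma eq_ps_ext f g : f =1 g -> ps_ext f =1 ps_ext g.
Proof. by move=> fg u; apply: eq_bigr => a _; rewrite fg. Qed.

Lemma ps_ext2E f u v :
  ps_ext2 f u v = \sum_(a : {set 'I_k}) u a *: ps_ext (f a) v.
Proof.
apply: eq_bigr => a _; rewrite scaler_sumr.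
by apply: eq_bigr => b _; rewrite scalerA.
Qed.

Lemma ps_ext2Er f u v :
  ps_ext2 f u v = \sum_(b : {set 'I_k}) v b *: ps_ext (f^~ b) u.
Proof.
rewrite /ps_ext2 exchange_big; apply: eq_bigr => b _; rewrite scaler_sumr.
by apply: eq_bigr => a _; rewrite scalerA mulrC.
Qed.

Fact ps_ext2_linearr f u : linear (ps_ext2 f u).
Proof.
move=> c v w; rewrite !ps_ext2E scaler_sumr -big_split.
by apply: eq_bigr => a _; rewrite linearP scalerDr !scalerA mulrC.
Qed.

Fact ps_ext2_linearl f v : linear (ps_ext2 f ^~ v).
Proof.
move=> c u w; rewrite !ps_ext2Er scaler_sumr -big_split.
by apply: eq_bigr => a _; rewrite linearP scalerDr !scalerA mulrC.
Qed.

Lemma ps_actM s t u : ps_act s (ps_act t u) = ps_act (t * s)%g u.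
Proof.
rewrite /ps_act ps_ext_comp; apply: eq_ps_ext => a /=.
by rewrite -imset_comp; apply: eq_imset => i /=; rewrite permM.
Qed.

Lemma ps_act_ext2 (f : {set 'I_k} -> {set 'I_k} -> {set 'I_k}) (s : 'S_k) u v :
    (forall a b, s @: f a b = f (s @: a) (s @: b)) ->
  ps_act s (ps_ext2 f u v) = ps_ext2 f (ps_act s u) (ps_act s v).
Proof.
move=> fs; rewrite ps_ext2E [RHS](_ : _ =
  \sum_a u a *: ps_ext2 f (ps_basis (s @: a)) (ps_act s v)); last first.
  rewrite {1}/ps_act {1}/ps_ext.
  pose L := HB.pack (ps_ext2 f ^~ (ps_act s v))
    (GRing.isLinear.Build K PS PS _ _ (ps_ext2_linearl f (ps_act s v)))
    : {linear PS -> PS}.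
  by rewrite -[LHS]/(L _) linear_sum; apply: eq_bigr => a _; rewrite linearZ.
rewrite /ps_act linear_sum; apply: eq_bigr => a _; rewrite linearZ /=.
congr (_ *: _); rewrite ps_ext2E (bigD1 (s @: a)) //= ffunE eqxx scale1r.
rewrite big1 ?addr0 => [|b /negPf ba]; last by rewrite ffunE ba scale0r.
by rewrite !ps_ext_comp; apply: eq_ps_ext => b /=; rewrite fs.
Qed.

Lemma coinv_ext2_wd (f : {set 'I_k} -> {set 'I_k} -> {set 'I_k}) u u' v v' :
    (forall (s : 'S_k) a b, s @: f a b = f (s @: a) (s @: b)) ->
    cls u = cls u' -> cls v = cls v' ->
  \sum_(s : 'S_k) cls (ps_ext2 f u (ps_act s v)) =
  \sum_(s : 'S_k) cls (ps_ext2 f u' (ps_act s v')).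
Proof.
move=> fs.
pose B u v : coinv := \sum_(s : 'S_k) cls (ps_ext2 f u (ps_act s v)).
rewrite -/(B u v) -/(B u' v').
have B_linr x : linear (B x).
  move=> c y z; rewrite /B scaler_sumr -big_split; apply: eq_bigr => s _ /=.
  by rewrite /ps_act linearP ps_ext2_linearr linearP.
have B_linl y : linear (B ^~ y).
  move=> c x z; rewrite /B scaler_sumr -big_split; apply: eq_bigr => s _ /=.
  by rewrite ps_ext2_linearl linearP.
have B_actr x y t : B x (ps_act t y) = B x y.
  rewrite /B [RHS](reindex_inj (mulgI t)).
  by apply: eq_bigr => s _; rewrite ps_actM.
have B_actl x y t : B (ps_act t x) y = B x y.
  rewrite /B (reindex_inj (mulIg t)).
  by apply: eq_bigr => s _; rewrite -ps_actM -ps_act_ext2 // cls_act.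
have B_kill (L : {linear PS -> coinv}) (w w' : PS) :
    (forall t x, L (ps_act t x) = L x) -> cls w = cls w' -> L w = L w'.
  move=> Lt /clsP[z ->]; rewrite linearD linear_sum big1 ?addr0 // => s _.
  by rewrite linearB /= Lt subrr.
move=> uu' vv'.
pose Ll := HB.pack (B ^~ v)
  (GRing.isLinear.Build K PS coinv _ _ (B_linl v)) : {linear PS -> coinv}.
pose Lr := HB.pack (B u')
  (GRing.isLinear.Build K PS coinv _ _ (B_linr u')) : {linear PS -> coinv}.
transitivity (B u' v).
  exact: (B_kill Ll _ _ (fun t x => B_actl x v t) uu').
exact: (B_kill Lr _ _ (fun t x => B_actr u' x t) vv').
Qed.

Lemma cls_repr x : cls (coinv_repr x) = x.
Proof. exact: quotv_reprK. Qed.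

Lemma coinv_unionE u v : coinv_union (cls u) (cls v) =
  (k`!%:R)^-1 *: \sum_(s : 'S_k) cls (ps_union u (ps_act s v)).
Proof.
congr (_ *: _); apply: coinv_ext2_wd; rewrite ?cls_repr // => s a b.
exact: imsetU.
Qed.

Lemma coinv_interE u v : coinv_inter (cls u) (cls v) =
  (k`!%:R)^-1 *: \sum_(s : 'S_k) cls (ps_inter u (ps_act s v)).
Proof.
congr (_ *: _); apply: coinv_ext2_wd; rewrite ?cls_repr // => s a b.
by apply: imsetI => x y _ _; apply: perm_inj.
Qed.

Lemma coinv_complE u : coinv_compl (cls u) = cls (ps_compl u).
Proof.
rewrite /coinv_compl; have /clsP[w ->] := cls_repr (cls u).
rewrite /ps_compl (linearD (ps_ext _)) (linear_sum (ps_ext _)) (linearD cls).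
rewrite -[RHS]addr0; congr (_ + _); rewrite linear_sum big1 // => s _.
rewrite (linearB (ps_ext _)) (linearB cls) /= -(cls_act s (ps_ext _ (w s))) /ps_act !ps_ext_comp.
rewrite (@eq_ps_ext _ ((fun c => s @: c) \o (fun a => ~: a))) ?subrr //= => a.
apply/setP=> i; rewrite -[i](permKV s) inE !mem_imset ?inE //;
  exact: perm_inj.
Qed.

End PowersetSpace.

(* Main.v *)
From HB Require Import structures.
Require Import Defs.
From mathcomp Require Import all_boot all_fingroup all_algebra.

Set Implicit Arguments.
Unset Strict Implicit.
Unset Printing Implicit Defensive.

Import GRing.Theory.
Local Open Scope ring_scope.

(** Two subsets are in the same orbit iff they have the same cardinality, so the
    class of a subset [c] is the hat of its size; the hats are independent
    because, for each [j], the sum of the coefficients on the subsets of size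
    [j] is an invariant linear form.  Averaging over [S_k] replaces [sigma b] by
    a uniformly distributed subset [c] with [#|c| = #|b|], and splitting [c]
    into its traces on [a] and on the complement of [a] counts how often each
    cardinality of [a :|: c] or [a :&: c] occurs. *)

(** * Subsets of a finite set: permutations, traces and averages *)

Section FiniteSets.

Variable T : finType.
Implicit Types A B C : {set T}.

(** Listing a set first and then its complement enumerates all of [T]. Matching the lists for [A]
    and [B] position by position gives a permutation, and the initial segments of equal length
    correspond. *)
Lemma card_eq_perm_imset A B :
  #|A| = #|B| -> exists s : {perm T}, s @: A = B.
Proof.
move=> AB; pose enumC (X : {set T}) := enum X ++ enum (~: X).
have enumCP X : perm_eq (enumC X) (enum T).
  apply: uniq_perm => [||x]; rewrite ?enum_uniq //.
    rewrite cat_uniq !enum_uniq andbT; apply/hasPn => x /=.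
    by rewrite !mem_enum inE.
  by rewrite mem_cat !mem_enum inE orbN.
have szC X : size (enumC X) = #|T| by rewrite (perm_size (enumCP X)) cardE.
have memC X x : x \in enumC X by rewrite (perm_mem (enumCP X)) mem_enum.
have uniqC X : uniq (enumC X) by rewrite (perm_uniq (enumCP X)) enum_uniq.
pose f x := nth x (enumC B) (index x (enumC A)).
have lt_index x : (index x (enumC A) < size (enumC B))%N.
  by rewrite szC -(szC A) index_mem.
(* The default of [nth] in [f] varies with the argument; it can be changed because the index is
   always in range. *)
have f_inj : injective f.
  move=> x y /eqP; rewrite /f (set_nth_default x y) // nth_uniq // => /eqP.
  by move=> /(congr1 (nth x (enumC A))); rewrite !nth_index.
exists (perm f_inj); apply/eqP.
rewrite eqEcard card_imset ?AB ?leqnn ?andbT; last exact: perm_inj.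
apply/subsetP => _ /imsetP[x xA ->]; rewrite permE /f index_cat mem_enum xA.
have lt_x : (index x (enum A) < size (enum B))%N.
  by rewrite -cardE -AB cardE index_mem mem_enum.
by rewrite nth_cat lt_x -mem_enum mem_nth.
Qed.

(** The map sending [C] to its traces on [A] and on [~: A] is a bijection onto pairs of subsets of
    the two, with union as its inverse. *)
Lemma card_traces A i j :
  #|[set C | (#|C :&: A| == i) && (#|C :\: A| == j)]| =
  ('C(#|A|, i) * 'C(#|~: A|, j))%N.
Proof.
rewrite -!cards_draws -cardsX.
set X := setX _ _.
have XP p : p \in X -> (p.1 :|: p.2) :&: A = p.1 /\ (p.1 :|: p.2) :\: A = p.2.
  case: p => D E; rewrite !inE /= => /andP[/andP[DA _] /andP[EA _]].
  have EA0 : E :&: A = set0 by apply/eqP; rewrite setI_eq0 disjoints_subset.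
  rewrite setIUl (setIidPl DA) EA0 setU0 setDUl; split=> //.
  by rewrite setDE [E :\: A]setDE (setIidPl EA) -setDE; move: DA;
    rewrite -setD_eq0 => /eqP->; rewrite set0U.
rewrite -(card_in_imset (f := fun p => p.1 :|: p.2) (D := mem X)).
  apply: eq_card => C; rewrite inE; apply/idP/imsetP => [/andP[Ci Cj]|[p pX ->]].
    exists (C :&: A, C :\: A); last by rewrite setID.
    by rewrite !inE /= subsetIr Ci Cj setDE subsetIr.
  have [-> ->] := XP p pX.
  by move: pX; rewrite !inE => /andP[/andP[_ ->] /andP[_ ->]].
move=> p q /XP[p1 p2] /XP[q1 q2] /= pq; rewrite pq in p1 p2.
by apply/pair_eqP; rewrite /pair_eq -p1 -p2 q1 q2 !eqxx.
Qed.

(** The permutations sending [B] to a given [C] of the same size form a coset of the stabilizer of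
    [B], so every such [C] is hit equally often. *)
Lemma sum_perm_imset (W : nmodType) B (F : {set T} -> W) :
  \sum_(s : {perm T}) F (s @: B) =
  (\sum_(C : {set T} | #|C| == #|B|) F C)
    *+ #|[set s : {perm T} | s @: B == B]|.
Proof.
rewrite (partition_big (fun s : {perm T} => s @: B)
          (fun C : {set T} => #|C| == #|B|)) /=; last first.
  by move=> s _; rewrite card_imset //; apply: perm_inj.
rewrite -sumrMnl; apply: eq_bigr => C /eqP CB.
rewrite (eq_bigr (fun=> F C)) => [|s /eqP-> //]; rewrite sumr_const.
(* Right multiplication by [t] carries the stabilizer of [B] onto the fibre over [C], since a
   product applies its left factor first. *)
have [t tB] := card_eq_perm_imset (esym CB).
congr (_ *+ _); rewrite -[RHS](card_imset _ (mulIg t)); apply: eq_card => s.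
have imsetM (u v : {perm T}) : (u * v)%g @: B = v @: (u @: B).
  by rewrite -imset_comp; apply: eq_imset => x; rewrite /= permM.
apply/idP/imsetP => [sB | [u uB ->]].
  exists (s * t^-1)%g; last by rewrite mulgKV.
  have /eqP sC : s @: B == C := sB.
  rewrite inE imsetM sC -tB -imset_comp (eq_imset (g := id)) ?imset_id //.
  by move=> x; rewrite /= permK.
move: uB; rewrite inE => /eqP uB.
suff /eqP : (u * t)%g @: B = C by [].
by rewrite imsetM uB.
Qed.

Lemma mean_perm_imset (K : fieldType) (W : lmodType K) B (F : {set T} -> W) :
    [pchar K] =i pred0 ->
  (#|T|`!%:R)^-1 *: (\sum_(s : {perm T}) F (s @: B)) =
  'C(#|T|, #|B|)%:R^-1 *: \sum_(C : {set T} | #|C| == #|B|) F C.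
Proof.
move=> charK0; rewrite sum_perm_imset.
set N := #|[set s : {perm T} | _]|.
have natr_neq0 n : (0 < n)%N -> n%:R != 0 :> K.
  by move=> n_gt0; rewrite ((pcharf0P K).1 charK0) -lt0n.
have card_permT : #|{: {perm T}}| = #|T|`!.
  rewrite -cardsT -card_perm; apply: eq_card => s; rewrite inE.
  by apply/esym/subsetP => x _; rewrite inE.
(* Orbit-stabilizer, read off from the preceding sum with [F] constantly 1. *)
have NE : #|T|`!%:R = N%:R * 'C(#|T|, #|B|)%:R :> K.
  have := sum_perm_imset B (fun=> 1 : K).
  rewrite !sumr_const card_permT -/N -cardsE card_draws => ->.
  by rewrite mulr_natl.
rewrite -scaler_nat scalerA NE invfM [_ / _ * _]mulrAC mulVf ?mul1r //.
(* [N] is invertible in [K] as a factor of a factorial, which is nonzero in characteristic zero. *)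
by apply: contraNneq (natr_neq0 _ (fact_gt0 #|T|)) => N0; rewrite NE N0 mul0r.
Qed.

Lemma sum_card_setD (W : nmodType) A (b : nat) (F : nat -> W) :
  \sum_(C : {set T} | #|C| == b) F #|C :\: A| =
  \sum_(0 <= l < (minn #|~: A| b).+1)
    F l *+ ('C(#|A|, b - l) * 'C(#|~: A|, l)).
Proof.
(* Group the sets [C] by the size of [C :\: A]. This size never exceeds the bound, so [inord] does
   not alter it. *)
rewrite big_mkord (partition_big
  (fun C => inord #|C :\: A| : 'I_(minn #|~: A| b).+1) xpredT) //=.
apply: eq_bigr => l _.
have le_l : (l <= minn #|~: A| b)%N by rewrite -ltnS ltn_ord.
(* This keeps the subtraction [b - l] from being truncated. *)
have le_lb : (l <= b)%N by apply: leq_trans le_l (geq_minr _ _).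
have condE C : (#|C| == b) && (inord #|C :\: A| == l) =
    (#|C :&: A| == b - l)%N && (#|C :\: A| == l).
  have le_C : #|C| = b -> (#|C :\: A| < (minn #|~: A| b).+1)%N.
    move=> <-; rewrite ltnS leq_min !subset_leq_card ?subsetDl //.
    by rewrite setDE subsetIr.
  apply/andP/andP => [[/eqP Cb /eqP <-] | [/eqP CI /eqP CD]].
    by rewrite inordK ?le_C // eqxx -Cb -(cardsID A C) addnK.
  have Cb : #|C| = b by rewrite -(cardsID A C) CI CD subnK.
  by rewrite Cb -val_eqE /= inordK ?le_C // CD.
rewrite (eq_bigl _ _ condE) -card_traces -sumr_const.
by apply: eq_big => [C | C /andP[_ /eqP->] //]; rewrite inE.
Qed.

Lemma sum_card_setI (W : nmodType) A (b : nat) (F : nat -> W) :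
  \sum_(C : {set T} | #|C| == b) F #|C :&: A| =
  \sum_(0 <= l < (minn #|A| b).+1)
    F l *+ ('C(#|A|, l) * 'C(#|~: A|, b - l)).
Proof.
have := sum_card_setD (~: A) b F; rewrite setCK => DA.
transitivity (\sum_(C : {set T} | #|C| == b) F #|C :\: ~: A|).
  by apply: eq_bigr => C _; rewrite setDE setCK.
by rewrite DA; apply: eq_bigr => l _; rewrite mulnC.
Qed.

End FiniteSets.

Lemma card_ltn_ord k a : (a <= k)%N -> #|[set i : 'I_k | (i < a)%N]| = a.
Proof.
move=> le_ak; rewrite -sum1dep_card -(big_ord_widen k (fun=> 1%N)) //.
by rewrite sum1_card card_ord.
Qed.

Lemma card_set_ord_leq k (A : {set 'I_k}) : (#|A| <= k)%N.
Proof. by rewrite -[X in (_ <= X)%N]card_ord max_card. Qed.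

Lemma free_map_iota (K : fieldType) (V : vectType K) (f : nat -> V) n :
    (forall c : 'I_n -> K, \sum_(i < n) c i *: f i = 0 -> forall i, c i = 0) ->
  free [seq f a | a <- iota 0 n].
Proof.
move=> f_free; have sz_f : size [seq f a | a <- iota 0 n] == n.
  by rewrite size_map size_iota.
rewrite -[X in free X]/(tval (Tuple sz_f)); apply/freeP => c c0.
apply: f_free; rewrite -[RHS]c0; apply: eq_bigr => i _.
by rewrite (nth_map 0%N) ?size_iota // nth_iota.
Qed.

(** * The basis of hats and the induced operations on it *)

Section Coinvariants.

Variables (K : fieldType) (k : nat).
Implicit Types (A B C : {set 'I_k}) (u : PS K k).

Lemma cls_basis A : cls (ps_basis K A) = hat K k #|A|.
Proof.
have [s sA] := card_eq_perm_imset (esym (card_ltn_ord (card_set_ord_leq A))).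
by rewrite -(cls_act s) /ps_act ps_ext_basis sA.
Qed.

Lemma ps_sum_basis u : u = \sum_A u A *: ps_basis K A.
Proof.
apply/ffunP => C; rewrite sum_ffunE (bigD1 C) //= big1 => [|A AC].
  by rewrite !ffunE eqxx addr0 [RHS]mulr1.
by rewrite !ffunE eq_sym (negPf AC) [LHS]mulr0.
Qed.

(** These invariant forms descend to the coinvariants, where they are the coordinates dual to the
    hats. *)
Definition ps_coef_card (j : nat) (u : PS K k) : K :=
  \sum_(A : {set 'I_k} | #|A| == j) u A.

Fact ps_coef_card_linear j : linear_for *%R (ps_coef_card j).
Proof.
move=> c u v; rewrite /ps_coef_card mulr_sumr -big_split.
by apply: eq_bigr => A _; rewrite !ffunE.
Qed.

HB.instance Definition _ j := GRing.isLinear.Build K (PS K k) K _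
  (ps_coef_card j) (ps_coef_card_linear j).

Lemma ps_coef_card_basis j A : ps_coef_card j (ps_basis K A) = (#|A| == j)%:R.
Proof.
rewrite /ps_coef_card; have [Aj | nAj] := eqVneq.
  rewrite (bigD1 A) /= ?Aj // ffunE eqxx big1 ?addr0 // => C /andP[_ CA].
  by rewrite ffunE (negPf CA).
rewrite big1 // => C Cj; rewrite ffunE.
by case: eqP => // CA; rewrite -CA Cj in nAj.
Qed.

Lemma ps_coef_card_act j s u : ps_coef_card j (ps_act s u) = ps_coef_card j u.
Proof.
rewrite [in RHS](ps_sum_basis u) /ps_act /ps_ext !linear_sum.
apply: eq_bigr => A _; rewrite !linearZ /= !ps_coef_card_basis card_imset //.
exact: perm_inj.
Qed.

Lemma ps_coef_card_cls j u : cls u = 0 -> ps_coef_card j u = 0.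
Proof.
(* Reading 0 as the class of 0 exhibits [u] as a sum of terms [ps_act s (w s) - w s], each killed by
   an invariant form. *)
rewrite -(linear0 (@cls K k)) => /clsP[w ->].
rewrite add0r linear_sum big1 // => s _.
by rewrite linearB /= ps_coef_card_act subrr.
Qed.

Lemma hat_basis : basis_of fullv [seq hat K k a | a <- iota 0 k.+1].
Proof.
rewrite /basis_of; apply/andP; split.
  rewrite eqEsubv subvf; apply/subvP => x _.
  rewrite -(cls_repr x) (ps_sum_basis (coinv_repr x)) linear_sum.
  apply: memv_suml => A _; rewrite linearZ; apply/rpredZ/memv_span.
  rewrite [X in X \in _]cls_basis.
  apply: (map_f (hat K k)); rewrite mem_iota add0n ltnS.
  by rewrite card_set_ord_leq andbT.
(* Independence: lift a vanishing combination to representatives; the form of index [j] then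
   isolates the coefficient [c j]. *)
apply: (@free_map_iota K (coinv K k) (hat K k)) => c.
under eq_bigr do rewrite /hat -linearZ.
rewrite -linear_sum => /ps_coef_card_cls coef0 j.
have hat_coef (i : 'I_k.+1) : ps_coef_card j
    (c i *: ps_basis K [set x : 'I_k | (x < i)%N]) = c i * (i == j)%:R.
  rewrite linearZ /= ps_coef_card_basis card_ltn_ord; last by rewrite -ltnS.
  by rewrite (inj_eq val_inj).
have := coef0 j; rewrite linear_sum (eq_bigr _ (fun i _ => hat_coef i)).
rewrite (bigD1 j) //= eqxx mulr1 big1 ?addr0 // => i /negPf->.
by rewrite mulr0.
Qed.

Lemma ps_ext2_basis f A B :
  ps_ext2 f (ps_basis K A) (ps_basis K B) = ps_basis K (f A B).
Proof.
rewrite ps_ext2E; under eq_bigr do rewrite ps_ext_basis.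
exact: (ps_ext_basis _ (f^~ B)).
Qed.

(** Common to union and intersection: what remains is to count the sizes of [f A C]. *)
Lemma mean_ext2_basis f A B : [pchar K] =i pred0 ->
  (k`!%:R)^-1 *:
    \sum_(s : 'S_k) cls (ps_ext2 f (ps_basis K A) (ps_act s (ps_basis K B))) =
  'C(k, #|B|)%:R^-1 *:
    \sum_(C : {set 'I_k} | #|C| == #|B|) hat K k #|f A C|.
Proof.
move=> charK0.
under eq_bigr do rewrite /ps_act ps_ext_basis ps_ext2_basis cls_basis.
have := mean_perm_imset B (fun C => hat K k #|f A C|) charK0.
by rewrite card_ord.
Qed.

Lemma coinv_union_hat a b :
    [pchar K] =i pred0 -> (a <= k)%N -> (b <= k)%N ->
  coinv_union (hat K k a) (hat K k b) =
    'C(k, b)%:R^-1 *: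
      \sum_(0 <= l < (minn (k - a) b).+1)
        ('C(a, b - l)%:R * 'C(k - a, l)%:R) *: hat K k (a + l).
Proof.
move=> charK0 le_ak le_bk; rewrite coinv_unionE mean_ext2_basis //.
rewrite card_ltn_ord //.
set A := [set i : 'I_k | _]; have cA : #|A| = a by rewrite card_ltn_ord.
have cAC : #|~: A| = (k - a)%N by rewrite cardsCs setCK cA card_ord.
(* Only the part of [C] outside [A] enlarges the union, whence the index [a + l]. *)
have cardUE C : #|A :|: C| = (a + #|C :\: A|)%N.
  by rewrite cardsU cA cardsD setIC addnBA // subset_leq_card ?subsetIl.
under eq_bigr do rewrite cardUE.
rewrite (sum_card_setD A b (fun l => hat K k (a + l))) cA cAC.
by congr (_ *: _); apply: eq_bigr => l _; rewrite -natrM scaler_nat.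
Qed.

Lemma coinv_inter_hat a b :
    [pchar K] =i pred0 -> (a <= k)%N -> (b <= k)%N ->
  coinv_inter (hat K k a) (hat K k b) =
    'C(k, b)%:R^-1 *:
      \sum_(0 <= l < (minn a b).+1)
        ('C(a, l)%:R * 'C(k - a, b - l)%:R) *: hat K k l.
Proof.
move=> charK0 le_ak le_bk; rewrite coinv_interE mean_ext2_basis //.
rewrite card_ltn_ord //.
set A := [set i : 'I_k | _]; have cA : #|A| = a by rewrite card_ltn_ord.
have cAC : #|~: A| = (k - a)%N by rewrite cardsCs setCK cA card_ord.
under eq_bigr do rewrite setIC.
rewrite (sum_card_setI A b (hat K k)) cA cAC.
by congr (_ *: _); apply: eq_bigr => l _; rewrite -natrM scaler_nat.
Qed.

Lemma coinv_compl_hat a : (a <= k)%N ->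
  coinv_compl (hat K k a) = hat K k (k - a).
Proof.
move=> le_ak; rewrite coinv_complE /ps_compl ps_ext_basis cls_basis.
by rewrite cardsCs setCK card_ltn_ord // card_ord.
Qed.

End Coinvariants.

Theorem theorem3p4 (K : fieldType) (charK0 : [pchar K] =i pred0)
    (k : nat) (k_ge1 : (1 <= k)%N) :
  basis_of fullv [seq hat K k a | a <- iota 0 k.+1]
  /\ forall a b : nat, (a <= k)%N -> (b <= k)%N ->
  [/\ coinv_union (hat K k a) (hat K k b) =
        'C(k, b)%:R^-1 *:
          \sum_(0 <= l < (minn (k - a) b).+1)
            ('C(a, b - l)%:R * 'C(k - a, l)%:R) *: hat K k (a + l),
      coinv_inter (hat K k a) (hat K k b) =
        'C(k, b)%:R^-1 *:
          \sum_(0 <= l < (minn a b).+1)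
            ('C(a, l)%:R * 'C(k - a, b - l)%:R) *: hat K k l
    & coinv_compl (hat K k a) = hat K k (k - a)].
Proof.
split=> [|a b le_ak le_bk]; first exact: hat_basis.
split; [exact: coinv_union_hat | exact: coinv_inter_hat |].
exact: coinv_compl_hat.
Qed.
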